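(* Let $p$ be an odd prime. There exist groups $G_1$ and $G_2$, each generated by two elements and of rank two, neither isomorphic to $C_p * C_p$, such that for all $i \geq 1$ $$G_1/\gamma_i(G_1) \cong G_2/\gamma_i(G_2) \cong (C_p*C_p)/\gamma_i(C_p*C_p).$$ Moreover, $G_1$ is residually nilpotent and $G_2$ is not residually nilpotent.
   Context: $C_p$ is the cyclic group of order $p$. The lower central series is $\gamma_1(G)=G$, $\gamma_k(G)=[G,\gamma_{k-1}(G)]$. A group $G$ is residually nilpotent if $\bigcap_{k\ge1}\gamma_k(G)=\{1\}$. The rank of a group is the minimum size of a generating set. *)

(* Defs.v *)
From mathcomp Require Import all_boot.

Record AbsGroup := {
  carrier :> Type;
  gmul : carrier -> carrier -> carrier;
  gone : carrier;
  ginv : carrier -> carrier;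
  gmulA : forall x y z, gmul x (gmul y z) = gmul (gmul x y) z;
  gmul1 : forall x, gmul gone x = x;
  gmulV : forall x, gmul (ginv x) x = gone
}.

Arguments gmul {a} _ _.
Arguments gone {a}.
Arguments ginv {a} _.

Fixpoint gpow (G : AbsGroup) (x : G) (n : nat) : G :=
  match n with O => gone | S m => gmul x (gpow G x m) end.

Inductive gen (G : AbsGroup) (S : G -> Prop) : G -> Prop :=
| gen_in : forall x, S x -> gen G S x
| gen_one : gen G S gone
| gen_mul : forall x y, gen G S x -> gen G S y -> gen G S (gmul x y)
| gen_inv : forall x, gen G S x -> gen G S (ginv x).

Definition comm (G : AbsGroup) (x y : G) : G :=
  gmul (gmul (ginv x) (ginv y)) (gmul x y).

(* Lower central series: gamma 1 = G, gamma (k+1) = [G, gamma k].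
   (gamma 0 is also set to G; only k >= 1 is used.) *)
Fixpoint gamma (G : AbsGroup) (k : nat) : G -> Prop :=
  match k with
  | O => fun _ => True
  | S O => fun _ => True
  | S k' => gen G (fun z => exists x y, gamma G k' y /\ z = comm G x y)
  end.

Definition residually_nilpotent (G : AbsGroup) : Prop :=
  forall x : G, (forall k, 1 <= k -> gamma G k x) -> x = gone.

Definition is_hom (G H : AbsGroup) (f : G -> H) : Prop :=
  forall x y, f (gmul x y) = gmul (f x) (f y).

Definition isomorphic (G H : AbsGroup) : Prop :=
  exists (f : G -> H) (g : H -> G),
    is_hom G H f /\ (forall x, g (f x) = x) /\ (forall y, f (g y) = y).

Definition congr_mod (G : AbsGroup) (N : G -> Prop) (x y : G) : Prop :=
  N (gmul (ginv x) y).

(* G/N isomorphic to H/M (N, M normal), expressed by maps on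
   representatives that induce mutually inverse maps of quotients,
   the first being a homomorphism of quotients. *)
Definition quot_iso (G : AbsGroup) (N : G -> Prop) (H : AbsGroup) (M : H -> Prop) : Prop :=
  exists (f : G -> H) (g : H -> G),
    (forall x y, congr_mod G N x y -> congr_mod H M (f x) (f y)) /\
    (forall x y, congr_mod H M x y -> congr_mod G N (g x) (g y)) /\
    (forall x y, congr_mod H M (f (gmul x y)) (gmul (f x) (f y))) /\
    (forall x, congr_mod G N (g (f x)) x) /\
    (forall y, congr_mod H M (f (g y)) y).

Definition rank_two (G : AbsGroup) : Prop :=
  (exists a b : G, forall z, gen G (fun w => w = a \/ w = b) z) /\
  ~ (exists a : G, forall z, gen G (fun w => w = a) z).

Definition is_free_prod_CpCp (p : nat) (F : AbsGroup) : Prop :=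
  exists a b : F,
    gpow F a p = gone /\ a <> gone /\
    gpow F b p = gone /\ b <> gone /\
    (forall z, gen F (fun w => w = a \/ w = b) z) /\
    (forall (H : AbsGroup) (x y : H), gpow H x p = gone -> gpow H y p = gone ->
       exists f : F -> H, is_hom F H f /\ f a = x /\ f b = y).

(* Main.v *)
Require Import Defs.
From mathcomp Require Import all_boot all_fingroup all_algebra.
From mathcomp Require Import ring zify.
From Stdlib Require Import ClassicalEpsilon FunctionalExtensionality.
From Stdlib Require Import PropExtensionality ProofIrrelevance.
Import GRing.Theory.

(* Let c(a,y) = y y a y^-1 a^-1, which is y modulo commutators. In a nilpotent group the
   equation c(a,y) = b has a solution y for all a and b, found by successive approximation
   along the lower central series. Hence the universal residually nilpotent group
   G1 = <a, y | a^p, c(a,y)^p> receives a homomorphism from C_p * C_p, sending the factors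
   to <a> and <c(a,y)>, that is an isomorphism modulo every term of the lower central
   series. For G2 take G1 x A_5, as A_5 is perfect.

   C_p * C_p is generated by two elements of order p, and neither G1 nor its product with
   A_5 is. Indeed G1 maps to SL_2(F_p(s)) by
     a |-> [1, s; 0, 1],   y |-> [1, -2 s^3 e; s, (1 - s^4) e],   e = 1/(1 + s^4);
   c(a,y) has trace 2, and residual nilpotence of the image holds as all matrices are 1
   modulo s. In a subgroup generated by two elements of order p, i.e. by two unipotent
   matrices A and B, all traces lie in F_p[u] with u = tr((A - 1)(B - 1)). Here
   tr(ay) - tr(y) = s^2 and tr(y) = 2 e, and no ring F_p[u] contains both: s^2 has a pole
   at infinity, hence u has one, hence every nonconstant element of F_p[u] has one. *)

(** * Elementary identities in groups *)

Section Elementary.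

Context {G : AbsGroup}.
Implicit Types x y z : G.

Lemma gmul_invr x : gmul x (ginv x) = gone.
Proof.
rewrite -[LHS]gmul1 -{1}(gmulV _ (ginv x)) -!gmulA (gmulA _ (ginv x) x) gmulV gmul1.
exact: gmulV.
Qed.

Lemma gmul_oner x : gmul x gone = x.
Proof. by rewrite -(gmulV _ x) gmulA gmul_invr gmul1. Qed.

Lemma gmul_invK x y : gmul (ginv x) (gmul x y) = y.
Proof. by rewrite gmulA gmulV gmul1. Qed.

Lemma gmul_Kinv x y : gmul x (gmul (ginv x) y) = y.
Proof. by rewrite gmulA gmul_invr gmul1. Qed.

Lemma gmul_cancel x y z : gmul x y = gmul x z -> y = z.
Proof. by move=> e; rewrite -(gmul_invK x y) e gmul_invK. Qed.

Lemma ginv_unique x y : gmul x y = gone -> ginv x = y.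
Proof. by move=> e; rewrite -(gmul_oner (ginv x)) -e gmul_invK. Qed.

Lemma ginv_inv x : ginv (ginv x) = x.
Proof. exact/ginv_unique/gmulV. Qed.

Lemma ginv_one : ginv (gone : G) = gone.
Proof. exact/ginv_unique/gmul1. Qed.

Lemma ginv_mul x y : ginv (gmul x y) = gmul (ginv y) (ginv x).
Proof. by apply: ginv_unique; rewrite -gmulA gmul_Kinv gmul_invr. Qed.

Lemma gmul_inv_eq x y : gmul (ginv x) y = gone -> x = y.
Proof. by move=> e; rewrite -(gmul_Kinv x y) e gmul_oner. Qed.

End Elementary.

(* A confluent rewriting system for the word problem in free groups. *)
Ltac group_nf :=
  rewrite /comm ?(ginv_mul, ginv_inv, ginv_one);
  repeat progress
    rewrite -?gmulA ?(gmul1, gmul_oner, gmulV, gmul_invr, gmul_invK, gmul_Kinv).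

Definition gconj (G : AbsGroup) (g x : G) : G := gmul (ginv g) (gmul x g).

(** * Subgroups, generation and homomorphisms *)

Record is_subgroup (G : AbsGroup) (N : G -> Prop) : Prop := IsSubgroup {
  sub_one : N gone;
  sub_mul : forall x y, N x -> N y -> N (gmul x y);
  sub_inv : forall x, N x -> N (ginv x)
}.

Arguments sub_one {G N}.
Arguments sub_mul {G N} _ {x y}.
Arguments sub_inv {G N} _ {x}.

Definition is_normal (G : AbsGroup) (N : G -> Prop) : Prop :=
  forall g x, N x -> N (gconj G g x).

Definition pair_set (G : AbsGroup) (a b : G) : G -> Prop := fun w => w = a \/ w = b.

Lemma gen_subgroup (G : AbsGroup) S : is_subgroup G (gen G S).
Proof. by split; [exact: gen_one | exact: gen_mul | exact: gen_inv]. Qed.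

Lemma gen_min (G : AbsGroup) (S N : G -> Prop) :
  is_subgroup G N -> (forall x, S x -> N x) -> forall x, gen G S x -> N x.
Proof.
move=> sN SN x; elim=> [y /SN//||y z _ Ny _ Nz|y _ Ny].
- exact: sub_one sN.
- exact: sub_mul.
- exact: sub_inv.
Qed.

Section Homs.

Context {G H : AbsGroup} {f : G -> H} (fM : is_hom G H f).

Lemma hom_one : f gone = gone.
Proof. by apply: (gmul_cancel (f gone)); rewrite -fM gmul1 gmul_oner. Qed.

Lemma hom_inv x : f (ginv x) = ginv (f x).
Proof. by apply/esym/ginv_unique; rewrite -fM gmul_invr hom_one. Qed.

Lemma hom_comm x y : f (comm G x y) = comm H (f x) (f y).
Proof. by rewrite /comm !fM !hom_inv. Qed.

Lemma hom_pow x n : f (gpow G x n) = gpow H (f x) n.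
Proof. by elim: n => [|n IH] /=; rewrite ?hom_one // fM IH. Qed.

Lemma hom_preim (N : H -> Prop) : is_subgroup H N -> is_subgroup G (fun x => N (f x)).
Proof.
move=> sN; split=> [|x y Nx Ny|x Nx]; rewrite ?hom_one ?fM ?hom_inv.
- exact: sub_one sN.
- exact: sub_mul.
- exact: sub_inv.
Qed.

Lemma hom_im (N : G -> Prop) :
  is_subgroup G N -> is_subgroup H (fun y => exists x, N x /\ f x = y).
Proof.
move=> sN; split.
- by exists gone; split; [exact: sub_one sN | exact: hom_one].
- move=> _ _ [x [Nx <-]] [y [Ny <-]]; exists (gmul x y).
  by split; [exact: sub_mul | rewrite fM].
- move=> _ [x [Nx <-]]; exists (ginv x).
  by split; [exact: sub_inv | rewrite hom_inv].
Qed.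

Lemma hom_gen (S : G -> Prop) (T : H -> Prop) :
  (forall x, S x -> T (f x)) -> forall x, gen G S x -> gen H T (f x).
Proof.
move=> ST; apply: gen_min; first exact/hom_preim/gen_subgroup.
by move=> x /ST; apply: gen_in.
Qed.

Lemma hom_gamma k x : gamma G k x -> gamma H k (f x).
Proof.
elim: k x => [//|[//|k] IH] x.
apply: hom_gen => _ [u [v [gv ->]]].
by exists (f u), (f v); split; [exact: IH | rewrite hom_comm].
Qed.

Lemma surj_gamma : (forall y, exists x, f x = y) ->
  forall k y, gamma H k y -> exists x, gamma G k x /\ f x = y.
Proof.
move=> fS; elim=> [|[|k] IH] y; try by have [x] := fS y; exists x.
apply: (gen_min _ _ (fun y => exists x, gamma G k.+2 x /\ f x = y)).
  by apply: hom_im; apply: gen_subgroup.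
move=> _ [u [v [gv ->]]]; have [x <-] := fS u; have [z [gz <-]] := IH v gv.
exists (comm G x z); split; last exact: hom_comm.
by apply: gen_in; exists x, z.
Qed.

End Homs.

Lemma hom_comp (G H K : AbsGroup) (f : G -> H) (g : H -> K) :
  is_hom G H f -> is_hom H K g -> is_hom G K (fun x => g (f x)).
Proof. by move=> fM gM x y; rewrite fM gM. Qed.

Lemma hom_eq_gen (G H : AbsGroup) (f g : G -> H) (S : G -> Prop) :
  is_hom G H f -> is_hom G H g -> (forall x, S x -> f x = g x) ->
  forall x, gen G S x -> f x = g x.
Proof.
move=> fM gM fg; apply: gen_min => //; split=> [|x y ex ey|x ex].
- by rewrite (hom_one fM) (hom_one gM).
- by rewrite fM gM ex ey.
- by rewrite (hom_inv fM) (hom_inv gM) ex.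
Qed.

Lemma gconj_hom (G : AbsGroup) (g : G) : is_hom G G (gconj G g).
Proof. by move=> x y; rewrite /gconj; group_nf. Qed.

(** * The lower central series *)

Lemma gamma_subgroup (G : AbsGroup) k : is_subgroup G (gamma G k).
Proof. by case: k => [|[|k]]; [split|split|exact: gen_subgroup]. Qed.

Lemma gamma_normal (G : AbsGroup) k : is_normal G (gamma G k).
Proof. by move=> g x; apply: hom_gamma; apply: gconj_hom. Qed.

Lemma gamma_comm (G : AbsGroup) k (x y : G) : 0 < k -> gamma G k y -> gamma G k.+1 (comm G x y).
Proof. by case: k => // k _ gy; apply: gen_in; exists x, y. Qed.

(** Once [gamma G k] is all of [G], every commutator lies in the next term, which therefore contains
    a generating set. *)
Lemma gamma_perfect (G : AbsGroup) (S : G -> Prop) :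
  (forall z, gen G S z) -> (forall z, S z -> exists u v, z = comm G u v) ->
  forall k z, gamma G k z.
Proof.
move=> GS Scomm; elim=> [//|[//|k] IH] z; move: (GS z).
apply: gen_min; first exact: gamma_subgroup.
by move=> _ /Scomm [u [v ->]]; apply: gamma_comm.
Qed.

(* The carrier consists of the equivalence classes, as predicates on [T]. *)
Lemma setoid_quotient (T : Type) (m : T -> T -> T) (e : T) (i : T -> T)
    (R : T -> T -> Prop) :
  (forall x, R x x) -> (forall x y, R x y -> R y x) ->
  (forall x y z, R x y -> R y z -> R x z) ->
  (forall x x' y y', R x x' -> R y y' -> R (m x y) (m x' y')) ->
  (forall x x', R x x' -> R (i x) (i x')) ->
  (forall x y z, R (m x (m y z)) (m (m x y) z)) ->
  (forall x, R (m e x) x) -> (forall x, R (m (i x) x) e) ->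
  exists (Q : AbsGroup) (pi : T -> Q),
    [/\ forall x y, pi (m x y) = gmul (pi x) (pi y), pi e = gone,
        forall x, pi (i x) = ginv (pi x),
        forall z, exists x, pi x = z & forall x y, pi x = pi y <-> R x y].
Proof.
move=> Rr Rs Rt Rm Ri RA R1 RV.
pose Q := {S : T -> Prop | exists x, S = R x}.
pose pi x : Q := exist _ (R x) (ex_intro _ x erefl).
have piE x y : pi x = pi y <-> R x y.
  split=> [[->] //|Rxy]; apply: eq_sig_hprop => [S|/=]; first exact: proof_irrelevance.
  apply: functional_extensionality => z; apply: propositional_extensionality.
  by split; apply: Rt => //; apply: Rs.
have piS (z : Q) : exists x, pi x = z.
  case: z => S [x Sx]; exists x.
  by apply: eq_sig_hprop => [?|//]; apply: proof_irrelevance.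
pose rep (z : Q) : T := proj1_sig (constructive_indefinite_description _ (piS z)).
have repK z : pi (rep z) = z by rewrite /rep; case: constructive_indefinite_description.
have Rrep x : R (rep (pi x)) x by apply/piE; rewrite repK.
pose mQ (x y : Q) := pi (m (rep x) (rep y)); pose iQ (x : Q) := pi (i (rep x)).
have mE x y : pi (m x y) = mQ (pi x) (pi y) by apply/piE; apply: Rm; apply: Rs.
have iE x : pi (i x) = iQ (pi x) by apply/piE; apply: Ri; apply: Rs.
have QA x y z : mQ x (mQ y z) = mQ (mQ x y) z.
  by rewrite -(repK x) -(repK y) -(repK z) -!mE; apply/piE.
have Q1 x : mQ (pi e) x = x by rewrite -{2}(repK x) -{1}(repK x) -mE; apply/piE.
have QV x : mQ (iQ x) x = pi e by rewrite -(repK x) -iE -mE; apply/piE.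
by exists (Build_AbsGroup Q mQ (pi e) iQ QA Q1 QV), pi.
Qed.

(** * Quotients by normal subgroups, subgroups and direct products *)

Lemma quotient_group (G : AbsGroup) (N : G -> Prop) :
  is_subgroup G N -> is_normal G N ->
  exists (Q : AbsGroup) (pi : G -> Q),
    [/\ is_hom G Q pi, forall z, exists x, pi x = z
      & forall x, pi x = gone <-> N x].
Proof.
move=> sN nN; pose R := congr_mod G N.
have Rr x : R x x by rewrite /R /congr_mod gmulV; exact: sub_one sN.
have [||||||||Q [pi [piM pi1 _ piS piE]]] := @setoid_quotient G gmul gone ginv R.
- exact: Rr.
- by move=> x y /(sub_inv sN); rewrite ginv_mul ginv_inv.
- by move=> x y z Rxy /(sub_mul sN Rxy); rewrite -gmulA gmul_Kinv.
(* Here (x y)^-1 (x' y') = (y^-1 (x^-1 x') y) (y^-1 y'); normality handles the first factor. *)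
- move=> x x' y y' Rx Ry; have := sub_mul sN (nN y _ Rx) Ry.
  by rewrite /R /congr_mod /gconj; group_nf.
- move=> x y /(sub_inv sN) /(nN (ginv x)).
  by rewrite /R /congr_mod /gconj; group_nf.
- by move=> x y z; rewrite gmulA.
- by move=> x; rewrite gmul1.
- by move=> x; rewrite gmulV.
exists Q, pi; split=> // x; rewrite -pi1 piE /R /congr_mod gmul_oner.
by split=> /(sub_inv sN); rewrite ?ginv_inv.
Qed.

Lemma subgroup_group (G : AbsGroup) (N : G -> Prop) : is_subgroup G N ->
  exists (H : AbsGroup) (i : H -> G),
    [/\ is_hom H G i, forall x y, i x = i y -> x = y
      & forall z, N z <-> exists x, i x = z].
Proof.
move=> [N1 NM NV]; pose H := {z : G | N z}.
have inj (x y : H) : proj1_sig x = proj1_sig y -> x = y.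
  by move=> e; apply: eq_sig_hprop => // ?; apply: proof_irrelevance.
pose mH (x y : H) : H := exist _ _ (NM _ _ (proj2_sig x) (proj2_sig y)).
pose iH (x : H) : H := exist _ _ (NV _ (proj2_sig x)).
have HA x y z : mH x (mH y z) = mH (mH x y) z by apply: inj; exact: gmulA.
have H1 x : mH (exist _ _ N1) x = x by apply: inj; exact: gmul1.
have HV x : mH (iH x) x = exist _ _ N1 by apply: inj; exact: gmulV.
exists (Build_AbsGroup H mH _ iH HA H1 HV), (@proj1_sig _ _); split=> // z.
by split=> [Nz|[[x Nx] <-//]]; exists (exist _ z Nz).
Qed.

Definition prod_group (G H : AbsGroup) : AbsGroup.
Proof.
refine (@Build_AbsGroup (G * H)%type (fun x y => (gmul x.1 y.1, gmul x.2 y.2))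
          (gone, gone) (fun x => (ginv x.1, ginv x.2)) _ _ _).
- by move=> x y z; rewrite /= !gmulA.
- by move=> [x y]; rewrite /= !gmul1.
- by move=> x; rewrite /= !gmulV.
Defined.

Lemma gamma_quotient (G : AbsGroup) k :
  exists (Q : AbsGroup) (pi : G -> Q),
    [/\ is_hom G Q pi, forall z, exists x, pi x = z,
        forall x, pi x = gone <-> gamma G k x
      & forall z, gamma Q k z -> z = gone].
Proof.
have [Q [pi [piM piS piE]]] :=
  quotient_group _ _ (gamma_subgroup G k) (gamma_normal G k).
exists Q, pi; split=> // z /(surj_gamma piM piS) [x [gx <-]]; exact/piE.
Qed.

(* In a quotient by the next term, [gamma G k] becomes central. *)
Lemma gamma_central (G Q : AbsGroup) (pi : G -> Q) k g : 0 < k ->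
  is_hom G Q pi -> (forall z, exists x, pi x = z) ->
  (forall x, pi x = gone <-> gamma G k.+1 x) ->
  gamma G k g -> forall z, gmul z (pi g) = gmul (pi g) z.
Proof.
move=> k0 piM piS piE gg z; have [x <-] := piS z.
have /piE := gamma_comm _ _ x g k0 gg; rewrite (hom_comm piM) => e.
by apply/esym/gmul_inv_eq; move: e; rewrite /comm; group_nf.
Qed.

(** * The relations [a^p = (y y a y^-1 a^-1)^p = 1] *)

Definition ctwist (G : AbsGroup) (a y : G) : G :=
  gmul y (gmul y (gmul a (gmul (ginv y) (ginv a)))).

Definition rels (p : nat) (G : AbsGroup) (a y : G) : Prop :=
  gpow G a p = gone /\ gpow G (ctwist G a y) p = gone.

Lemma hom_ctwist (G H : AbsGroup) (f : G -> H) : is_hom G H f ->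
  forall a y, f (ctwist G a y) = ctwist H (f a) (f y).
Proof. by move=> fM a y; rewrite /ctwist !fM !(hom_inv fM). Qed.

(** The exponents of [y] in [ctwist] sum to one. The error [g] of an approximate solution [y]
    becomes central modulo the next term of the series, so multiplying [y] by [ginv g] multiplies
    the value by [ginv g] and removes the error. *)
Lemma ctwist_solve (G : AbsGroup) (a b : G) k :
  exists y, gamma G k (gmul (ginv b) (ctwist G a y)).
Proof.
elim: k => [|k [y gy]]; first by exists gone.
case: k gy => [|k] gy; first by exists gone.
set g := gmul _ _ in gy; exists (gmul y (ginv g)).
have [Q [pi [piM piS piE _]]] := gamma_quotient G k.+2.
have Zg := gamma_central _ _ _ _ _ (ltn0Sn k) piM piS piE gy.
have yE : ctwist G a y = gmul b g by rewrite /g gmul_Kinv.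
apply/piE; rewrite piM (hom_inv piM) (hom_ctwist _ _ _ piM) piM (hom_inv piM).
have := congr1 pi yE; rewrite piM (hom_ctwist _ _ _ piM) => e.
have ZgV z : gmul z (ginv (pi g)) = gmul (ginv (pi g)) z.
  by apply: (gmul_cancel (pi g)); rewrite gmul_Kinv gmulA -Zg -gmulA gmul_invr gmul_oner.
have -> : ctwist Q (pi a) (gmul (pi y) (ginv (pi g))) =
          gmul (ginv (pi g)) (ctwist Q (pi a) (pi y)).
  rewrite /ctwist ginv_mul ginv_inv -!gmulA (gmulA _ (pi a) (pi g)) Zg.
  by rewrite -!gmulA gmul_invK gmulA ZgV -!gmulA.
by rewrite -ZgV e; group_nf.
Qed.

(** The identity y = c(a,y) (a y a^-1 y^-1) recovers [y] from [ctwist G a y] and a commutator.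
    Replacing [y] in that commutator by an element of [S] congruent to it modulo one term of the
    series changes the commutator only modulo the next term. Hence [S] approximates [y] to every
    order. *)
Lemma subgroup_mod_gamma (G : AbsGroup) (a y : G) (S : G -> Prop) :
  (forall z, gen G (pair_set G a y) z) -> is_subgroup G S ->
  S a -> S (ctwist G a y) ->
  forall k z, exists s, S s /\ gamma G k (gmul (ginv s) z).
Proof.
move=> Gay sS Sa Sc k.
have key : exists s, S s /\ gamma G k (gmul (ginv s) y).
  elim: k => [|k [s [Ss gs]]]; first by exists gone; split=> //; exact: sub_one sS.
  case: k gs => [|k] gs; first by exists gone; split=> //; exact: sub_one sS.
  pose t := gmul (ctwist G a y) (gmul a (gmul s (gmul (ginv a) (ginv s)))).
  exists t; split.
    by do !apply: (sub_mul sS) => //; apply: (sub_inv sS).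
  set g := gmul _ _ in gs.
  have [Q [pi [piM piS piE _]]] := gamma_quotient G k.+2.
  have Zg := gamma_central _ _ _ _ _ (ltn0Sn k) piM piS piE gs.
  apply/piE; rewrite piM (hom_inv piM).
  suff -> : pi t = pi y by rewrite gmulV.
  have yE : pi y = gmul (pi s) (pi g) by rewrite -piM /g gmul_Kinv.
  suff e : pi (gmul a (gmul s (gmul (ginv a) (ginv s)))) =
           pi (gmul a (gmul y (gmul (ginv a) (ginv y)))).
    by rewrite /t piM e -piM /ctwist; congr pi; group_nf.
  rewrite !piM !(hom_inv piM) yE ginv_mul -!gmulA.
  by rewrite (gmulA _ (pi g)) -Zg -gmulA gmul_Kinv.
move: key => [s [Ss gs]].
have [Q [pi [piM piS piE _]]] := gamma_quotient G k.
have all z : exists s', S s' /\ pi s' = pi z.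
  move: (Gay z); apply: (gen_min _ _ (fun z => exists s', S s' /\ pi s' = pi z)).
    split.
  - by exists gone; split=> //; exact: sub_one sS.
  - move=> u v [u' [Su eu]] [v' [Sv ev]]; exists (gmul u' v').
    by split; [exact: sub_mul | rewrite !piM eu ev].
  - move=> u [u' [Su eu]]; exists (ginv u').
    by split; [exact: sub_inv | rewrite !(hom_inv piM) eu].
  move=> _ [|] ->; first by exists a.
  by exists s; split=> //; apply: gmul_inv_eq; rewrite -(hom_inv piM) -piM; apply/piE.
move=> z; have [s' [Ss' e]] := all z; exists s'; split=> //.
by apply/piE; rewrite piM (hom_inv piM) e gmulV.
Qed.

Inductive term := TA | TY | TOne | TMul of term & term | TInv of term.

Fixpoint teval (G : AbsGroup) (a y : G) (t : term) : G :=
  match t with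
  | TA => a
  | TY => y
  | TOne => gone
  | TMul s t => gmul (teval G a y s) (teval G a y t)
  | TInv t => ginv (teval G a y t)
  end.

(* Identifying terms that agree in all residually nilpotent groups with the relations
   makes the group residually nilpotent by construction. *)
Lemma universal_group (p : nat) :
  exists (G : AbsGroup) (a y : G),
    [/\ residually_nilpotent G, rels p G a y,
        forall z, gen G (pair_set G a y) z
      & forall (H : AbsGroup) (b x : H), residually_nilpotent H -> rels p H b x ->
        exists f : G -> H, [/\ is_hom G H f, f a = b & f y = x]].
Proof.
pose R s t := forall (H : AbsGroup) (b x : H), residually_nilpotent H ->
  rels p H b x -> teval H b x s = teval H b x t.
have [||||||||Q [pi [piM pi1 piV piS piE]]] := @setoid_quotient term TMul TOne TInv R.
- by [].
- by move=> s t Rst H b x rn r; rewrite (Rst H b x).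
- by move=> s t u Rst Rtu H b x rn r; rewrite (Rst H b x) // (Rtu H b x).
- by move=> s s' t t' Rs Rt H b x rn r /=; rewrite (Rs H b x) // (Rt H b x).
- by move=> s t Rst H b x rn r /=; rewrite (Rst H b x).
- by move=> s t u H b x rn r /=; rewrite gmulA.
- by move=> s H b x rn r /=; rewrite gmul1.
- by move=> s H b x rn r /=; rewrite gmulV.
have evE t : teval Q (pi TA) (pi TY) t = pi t.
  by elim: t => //= [s -> t ->|t ->]; rewrite ?piM ?piV.
have univ (H : AbsGroup) (b x : H) : residually_nilpotent H -> rels p H b x ->
    exists f : Q -> H, is_hom Q H f /\ forall t, f (pi t) = teval H b x t.
  move=> rn r.
  pose rep z := proj1_sig (constructive_indefinite_description _ (piS z)).
  have repK z : pi (rep z) = z by rewrite /rep; case: constructive_indefinite_description.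
  have fE t : teval H b x (rep (pi t)) = teval H b x t.
    by have /piE/(_ H b x rn r) := repK (pi t).
  exists (fun z => teval H b x (rep z)); split=> // u v.
  by rewrite -{1}(repK u) -{1}(repK v) -piM fE.
exists Q, (pi TA), (pi TY); split.
(* An element of all terms of the series maps into all terms for each residually nilpotent [H] with
   the relations, hence to the identity. This is the condition under which its word [t] is
   identified with [TOne]. *)
- move=> z gz; have [t tz] := piS z; rewrite -tz -pi1; apply/piE => H b x rn r.
  have [f [fM fE]] := univ H b x rn r.
  rewrite -fE tz; apply: rn => k k1; apply: (hom_gamma fM); exact: gz.
- pose tpow t n := iter n (TMul t) TOne.
  have powE t n : gpow Q (pi t) n = pi (tpow t n).
    by elim: n => [|n IH] /=; rewrite ?pi1 // piM IH.
  have tpowE H b x t n : teval H b x (tpow t n) = gpow H (teval H b x t) n.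
    by elim: n => //= n ->.
  split; rewrite /ctwist -?piV -?piM powE -pi1.
    by apply/piE => H b x _ [r _]; rewrite tpowE.
  by apply/piE => H b x _ [_ r]; rewrite tpowE.
- move=> z; have [t <-] := piS z; elim: t => [||||].
  + by apply: gen_in; left.
  + by apply: gen_in; right.
  + by rewrite pi1; apply: gen_one.
  + by move=> s gs t gt; rewrite piM; apply: gen_mul.
  + by move=> t gt; rewrite piV; apply: gen_inv.
- move=> H b x rn r; have [f [fM fE]] := univ H b x rn r.
  by exists f; split.
Qed.

(** * Linear groups *)

Section LinearGroups.

Local Open Scope ring_scope.

(** * Two-by-two matrices *)

Lemma ord2P (i : 'I_2) : i = 0 \/ i = 1.
Proof. by case: i => [[|[|//]] ?]; [left | right]; apply: val_inj. Qed.

Lemma mx2P (R : pzRingType) (A B : 'M[R]_2) :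
  A 0 0 = B 0 0 -> A 0 1 = B 0 1 -> A 1 0 = B 1 0 -> A 1 1 = B 1 1 -> A = B.
Proof.
move=> e00 e01 e10 e11; apply/matrixP.
by move=> i j; case: (ord2P i) => ->; case: (ord2P j) => ->.
Qed.
Lemma det2 (R : comPzRingType) (A : 'M[R]_2) :
  \det A = A 0 0 * A 1 1 - A 0 1 * A 1 0.
Proof.
rewrite (expand_det_row _ 0) !big_ord_recl big_ord0 /cofactor !det_mx11 !mxE /=.
have -> : lift 0 0 = 1 :> 'I_2 by apply: val_inj.
have -> : lift 1 0 = 0 :> 'I_2 by apply: val_inj.
by rewrite expr0 expr1 addr0 mul1r mulN1r mulrN.
Qed.
Lemma trace2 (R : pzRingType) (A : 'M[R]_2) : \tr A = A 0 0 + A 1 1.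
Proof. 
rewrite /mxtrace !big_ord_recl big_ord0 addr0.
by have -> : lift 0 0 = 1 :> 'I_2 by apply: val_inj.
Qed.
Lemma mul2 (R : pzRingType) (A B : 'M[R]_2) i j :
  (A *m B) i j = A i 0 * B 0 j + A i 1 * B 1 j.
Proof.
rewrite mxE !big_ord_recl big_ord0 addr0.
by have -> : lift 0 0 = 1 :> 'I_2 by apply: val_inj.
Qed.
Definition mx2 (R : pzRingType) (a b c d : R) : 'M[R]_2 :=
  \matrix_(i, j) if i == 0 then (if j == 0 then a else b) else (if j == 0 then c else d).

Lemma mx2E (R : pzRingType) (a b c d : R) :
  (mx2 _ a b c d 0 0 = a) * (mx2 _ a b c d 0 1 = b) *
  (mx2 _ a b c d 1 0 = c) * (mx2 _ a b c d 1 1 = d).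
Proof. by rewrite !mxE. Qed.

Lemma cayley_hamilton2 (R : comNzRingType) (A : 'M[R]_2) :
  A * A = \tr A *: A - (\det A)%:M.
Proof. by rewrite det2 trace2; apply: mx2P; rewrite !mul2 !mxE /=; ring. Qed.

(** * Residual nilpotence of congruence subgroups of [SL_2] *)

Section CongruenceGroup.

Context {K : comNzRingType} (I : nat -> K -> Prop).
Hypothesis I0 : forall n, I n 0.
Hypothesis ID : forall n x y, I n x -> I n y -> I n (x + y).
Hypothesis IN : forall n x, I n x -> I n (- x).
Hypothesis IM : forall m n x y, I m x -> I n y -> I (m + n)%N (x * y).
Hypothesis IS : forall n x, I n.+1 x -> I n x.
Hypothesis Isep : forall x, (forall n, I n x) -> x = 0.

Let J n (A : 'M[K]_2) := forall i j, I n (A i j).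

Let JD n A B : J n A -> J n B -> J n (A + B).
Proof. by move=> JA JB i j; rewrite mxE; apply: ID. Qed.

Let JN n A : J n A -> J n (- A).
Proof. by move=> JA i j; rewrite mxE; apply: IN. Qed.

Let JM m n A B : J m A -> J n B -> J (m + n) (A * B).
Proof. by move=> JA JB i j; rewrite mul2; apply: ID; apply: IM. Qed.

Let JleD m n A : J (m + n) A -> J n A.
Proof. by elim: m => // m IHm JA; apply: IHm => i j; apply: IS; apply: JA. Qed.

Let Jmul1 m n A B : J m (A - 1) -> J n B -> J n (A * B).
Proof.
move=> JA JB; rewrite -[A](subrK 1) mulrDl mul1r; apply: JD => //.
by apply: (JleD m); apply: JM.
Qed.

(** [(\tr A)%:M - A] is the adjugate of [A], which is the inverse when the determinant is 1. *)
Let Jinv n A : J n (A - 1) -> J n ((\tr A)%:M - A - 1).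
Proof.
move=> JA; have -> : (\tr A)%:M - A - 1 = (\tr (A - 1))%:M - (A - 1).
  by rewrite !trace2; apply: mx2P; rewrite !mxE /=; ring.
apply: JD (JN _ _ JA) => i j; rewrite mxE trace2.
by case: (i == j); [apply: ID; apply: JA | rewrite mulr0n].
Qed.

(** Commutators raise the filtration degree: the k-th term of the series consists of matrices
    congruent to 1 modulo [I k], and the [I k] have intersection zero. In the application [I n] is
    the n-th power of the maximal ideal of a local ring inside [K], so [I 0] is that ring and not
    all of [K]. *)
Lemma congruence_group : exists (G : AbsGroup) (rho : G -> 'M[K]_2),
  [/\ residually_nilpotent G, rho gone = 1,
      forall g h, rho (gmul g h) = rho g * rho h,
      forall g h, rho g = rho h -> g = h
    & forall A, \det A = 1 -> J 1 (A - 1) -> exists g, rho g = A].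
Proof.
pose P A := \det A = 1 /\ J 1 (A - 1).
have P1 : P 1 by split; [exact: det1 | move=> i j; rewrite subrr mxE].
have PM A B : P A -> P B -> P (A * B).
  move=> [dA JA] [dB JB]; split; first by rewrite detM dA dB mulr1.
  have -> : A * B - 1 = A * (B - 1) + (A - 1) by rewrite mulrBr mulr1 addrA subrK.
  by apply: JD => //; apply: (Jmul1 1).
have PV A : P A -> P ((\tr A)%:M - A).
  move=> [dA JA]; split; last exact: Jinv.
  by rewrite -dA !det2 trace2 !mxE /=; ring.
have VP A : P A -> ((\tr A)%:M - A) * A = 1.
  move=> [dA _]; rewrite mulrBl cayley_hamilton2 dA -scalemx1.
  by rewrite -scalerAl mul1r opprB addrC subrK.
pose C := {A | P A}.
have inj (g h : C) : proj1_sig g = proj1_sig h -> g = h.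
  by move=> e; apply: eq_sig_hprop => // ?; apply: proof_irrelevance.
pose mC (g h : C) : C := exist _ _ (PM _ _ (proj2_sig g) (proj2_sig h)).
pose iC (g : C) : C := exist _ _ (PV _ (proj2_sig g)).
have CA g h k : mC g (mC h k) = mC (mC g h) k by apply: inj; exact: mulrA.
have C1 g : mC (exist _ _ P1) g = g by apply: inj; exact: mul1r.
have CV g : mC (iC g) g = exist _ _ P1 by apply: inj; exact: VP (proj2_sig g).
pose G := Build_AbsGroup C mC _ iC CA C1 CV.
pose rho (g : G) := proj1_sig g.
have rhoM (g h : G) : rho (gmul g h) = rho g * rho h by [].
have gammaJ k (g : G) : gamma G k.+1 g -> J k.+1 (rho g - 1).
  elim: k g => [|k IHk] g; first by have [] := proj2_sig g.
  apply: (gen_min _ _ (fun g => J k.+2 (rho g - 1))).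
    split=> [i j|x y Jx Jy|x Jx]; first by rewrite subrr mxE.
      rewrite rhoM.
      have -> : rho x * rho y - 1 = rho x * (rho y - 1) + (rho x - 1).
        by rewrite mulrBr mulr1 addrA subrK.
      by apply: JD => //; apply: Jmul1 Jx Jy.
    exact: Jinv.
  move=> _ [x [y [/IHk Jy ->]]].
  have Jx : J 1 (rho x - 1) by have [] := proj2_sig x.
  set u := gmul (ginv x) (ginv y).
  have Ju : J 1 (rho u - 1) by have [] := proj2_sig u.
  (* Writing 1 as [rho u * (rho y * rho x)] turns the commutator minus 1 into [rho u] times an
     additive commutator, which does not change when 1 is subtracted from both of its arguments. *)
  have e1 : rho u * (rho y * rho x) = 1.
    by rewrite -!rhoM /u -gmulA gmul_invK gmulV.
  have -> : rho (comm G x y) - 1 =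
      rho u * ((rho x - 1) * (rho y - 1) - (rho y - 1) * (rho x - 1)).
    rewrite -[X in _ - X]e1 /comm !rhoM -mulrBr; congr (_ * _).
    rewrite !mulrBl !mulrBr !mulr1 !mul1r.
    move: (rho x * rho y) (rho y * rho x) => XY YX.
    by apply/matrixP => i j; rewrite !mxE; ring.
  apply: Jmul1 Ju _; apply: JD; first exact: (JM 1).
  by apply: JN; rewrite -[k.+2]addn1; apply: JM.
exists G, rho; split=> //.
  move=> g gg; apply: inj; apply/eqP; rewrite -subr_eq0; apply/eqP/matrixP => i j.
  rewrite [RHS]mxE; apply: Isep => n; apply: IS.
  exact: (gammaJ n g (gg n.+1 isT)).
by move=> A dA JA; exists (exist _ A (conj dA JA)).
Qed.

End CongruenceGroup.

(** * Traces in groups generated by two unipotent matrices *)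

Section Traces.

Context {F K : fieldType} (iota : {rmorphism F -> K}).

(** This is the subring [F[u]] of [K]. *)
Definition polyval (u x : K) := exists f : {poly F}, x = (map_poly iota f).[u].

Lemma polyvalD u x y : polyval u x -> polyval u y -> polyval u (x + y).
Proof. by move=> [f ->] [g ->]; exists (f + g); rewrite rmorphD hornerD. Qed.

Lemma polyvalN u x : polyval u x -> polyval u (- x).
Proof. by move=> [f ->]; exists (- f); rewrite rmorphN hornerN. Qed.

Lemma polyvalM u x y : polyval u x -> polyval u y -> polyval u (x * y).
Proof. by move=> [f ->] [g ->]; exists (f * g); rewrite rmorphM hornerM. Qed.

Lemma polyval0 u : polyval u 0.
Proof. by exists 0; rewrite rmorph0 horner0. Qed.

Lemma polyval1 u : polyval u 1.
Proof. by exists 1; rewrite rmorph1 hornerC. Qed.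

Lemma polyvalX u : polyval u u.
Proof. by exists 'X; rewrite map_polyX hornerX. Qed.

(** By Frobenius, N = A - 1 satisfies N^p = A^p - 1 = 0, so its determinant vanishes and
    Cayley-Hamilton reads N^2 = tr(N) N. Then N^p = tr(N)^(p-1) N, which forces tr(N) = 0 or N =
    0. *)
Lemma torsion_unipotent p (A : 'M[K]_2) : p \in [pchar K] -> A ^+ p = 1 ->
  \tr (A - 1) = 0 /\ (A - 1) * (A - 1) = 0.
Proof.
move=> pK Ap; set N := A - 1.
have pM : p \in [pchar 'M[K]_2] by rewrite pchar_lalg.
have p0 := prime_gt0 (pcharf_prime pK).
have Np : N ^+ p = 0.
  rewrite -(pFrobenius_autE pM) pFrobenius_autB_comm; last exact: commr1.
  by rewrite !pFrobenius_autE Ap expr1n subrr.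
have dN : \det N = 0.
  have : \det N ^+ p = 0.
    suff <- : \det (N ^+ p) = \det N ^+ p by rewrite Np det0.
    by elim: (p) => [|n IH]; rewrite ?expr0 ?det1 // !exprS detM IH.
  by move/eqP; rewrite expf_eq0 p0 => /eqP.
have NN : N * N = \tr N *: N by rewrite cayley_hamilton2 dN raddf0 subr0.
suff tN : \tr N = 0 by rewrite NN tN scale0r.
have NpE n : N ^+ n.+1 = \tr N ^+ n *: N.
  elim: n => [|n IH]; first by rewrite expr1 expr0 scale1r.
  by rewrite exprS IH -scalerAr NN scalerA -exprSr.
move: Np; rewrite -(prednK p0) NpE => /eqP.
rewrite scaler_eq0 expf_eq0 => /orP [/andP [_ /eqP //]|/eqP ->].
exact: raddf0.
Qed.

(* With [N = A - 1], [M = B - 1] and [u = tr (N M)], the relations [N^2 = M^2 = 0] and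
   [N M + M N = u] show that the [F[u]]-span of [1, N, M, N M] is an algebra. *)
Lemma two_torsion_traces p (G : AbsGroup) (rho : G -> 'M[K]_2) (a b : G) :
  p \in [pchar K] -> rho gone = 1 ->
  (forall g h, rho (gmul g h) = rho g * rho h) ->
  gpow G a p = gone -> gpow G b p = gone ->
  exists u, forall g, gen G (pair_set G a b) g -> polyval u (\tr (rho g)).
Proof.
move=> pK rho1 rhoM ap bp.
have rhoX g n : rho (gpow G g n) = rho g ^+ n.
  by elim: n => [|n IH] //=; rewrite rhoM IH exprS.
have unip g : gpow G g p = gone ->
    \tr (rho g - 1) = 0 /\ (rho g - 1) * (rho g - 1) = 0.
  by move=> gp; apply: torsion_unipotent pK _; rewrite -rhoX gp.
have [trN NN] := unip a ap; have [trM MM] := unip b bp.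
set N := rho a - 1 in trN NN; set M := rho b - 1 in trM MM.
have aE : rho a = N + 1 by rewrite subrK.
have bE : rho b = M + 1 by rewrite subrK.
clearbody N M; set u := \tr (N * M); exists u.
(* This is the polarized Cayley-Hamilton identity for matrices of trace zero. *)
have MN : M * N = u%:M - N * M.
  have n11 : N 1 1 = - N 0 0 by apply/eqP; rewrite -addr_eq0 addrC -trace2 trN.
  have m11 : M 1 1 = - M 0 0 by apply/eqP; rewrite -addr_eq0 addrC -trace2 trM.
  rewrite /u trace2.
  by apply: mx2P; rewrite [RHS]mxE [X in _ = _ + X]mxE !mul2 !mxE /= ?n11 ?m11; ring.
pose Sp A := exists x y z w : K,
  [/\ polyval u x, polyval u y, polyval u z, polyval u w
    & A = x%:M + y *: N + z *: M + w *: (N * M)].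
have SpD A B : Sp A -> Sp B -> Sp (A + B).
  move=> [x [y [z [w [Tx Ty Tz Tw ->]]]]] [x' [y' [z' [w' [Tx' Ty' Tz' Tw' ->]]]]].
  exists (x + x'), (y + y'), (z + z'), (w + w'); split; try exact: polyvalD.
  by rewrite raddfD /= !scalerDl; move: (N * M) => L; apply/matrixP => i j; rewrite !mxE; ring.
have SpN A : Sp A -> Sp (- A).
  move=> [x [y [z [w [Tx Ty Tz Tw ->]]]]].
  exists (- x), (- y), (- z), (- w); split; try exact: polyvalN.
  by rewrite raddfN /= !scaleNr !opprD.
have SpNM A : Sp A -> Sp (N * A).
  move=> [x [y [z [w [Tx Ty Tz Tw ->]]]]].
  exists 0, x, 0, z; split=> //; try exact: polyval0.
  rewrite !mulrDr -!scalerAr mulrA NN mul0r !scaler0 -scalemx1 -scalerAr mulr1.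
  by rewrite raddf0 scale0r !addr0 !add0r.
have SpMM A : Sp A -> Sp (M * A).
  move=> [x [y [z [w [Tx Ty Tz Tw ->]]]]].
  exists (y * u), 0, (x + w * u), (- y); split.
  - by apply: polyvalM => //; apply: polyvalX.
  - exact: polyval0.
  - by apply: polyvalD => //; apply: polyvalM => //; apply: polyvalX.
  - exact: polyvalN.
  have MNM : M * (N * M) = u *: M.
    by rewrite mulrA MN mulrBl -mulrA MM mulr0 subr0; exact: mul_scalar_mx.
  have Mx : M * x%:M = x *: M by exact: mul_mx_scalar.
  rewrite !mulrDr -!scalerAr MM MN MNM Mx scaler0 scalerBr scalerA scale_scalar_mx.
  move: (N * M) => L; by apply/matrixP => i j; rewrite !mxE; ring.
have Sp1 : Sp 1.
  exists 1, 0, 0, 0; split; try exact: polyval0; first exact: polyval1.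
  by rewrite !scale0r !addr0.
have rhoV g : rho (ginv g) * rho g = 1 by rewrite -rhoM gmulV.
have inv1 g L : rho g - 1 = L -> L * L = 0 -> rho (ginv g) = 1 - L.
  move=> gL LL; have gE : rho g = 1 + L by rewrite -gL addrC subrK.
  have gV : rho g * (1 - L) = 1 by rewrite gE mulrBr mulr1 mulrDl mul1r LL addr0 addrK.
  by rewrite -[LHS]mulr1 -[X in _ * X = _]gV mulrA rhoV mul1r.
(* The span is shown to be stable under left multiplication by [rho g] and by [rho (ginv g)]
   together, so that the induction passes through inverses. Applied to 1, stability gives membership
   of [rho g]. *)
have key g : gen G (pair_set G a b) g ->
    (forall A, Sp A -> Sp (rho g * A)) /\ (forall A, Sp A -> Sp (rho (ginv g) * A)).
  apply: (gen_min _ _ (fun g => (forall A, Sp A -> Sp (rho g * A)) /\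
     (forall A, Sp A -> Sp (rho (ginv g) * A)))).
    split=> [|x y [Sx Vx] [Sy Vy]|x [Sx Vx]].
    - by rewrite ginv_one rho1; split=> A; rewrite mul1r.
    - rewrite ginv_mul !rhoM; split=> A SA; rewrite -mulrA; [exact/Sx/Sy | exact/Vy/Vx].
    - by rewrite ginv_inv.
  move=> _ [] ->; split=> A SA.
  - by rewrite aE mulrDl mul1r; apply: SpD => //; apply: SpNM.
  - by rewrite (inv1 a N) ?aE ?addrK // mulrBl mul1r; apply: SpD => //; apply: SpN; apply: SpNM.
  - by rewrite bE mulrDl mul1r; apply: SpD => //; apply: SpMM.
  - by rewrite (inv1 b M) ?bE ?addrK // mulrBl mul1r; apply: SpD => //; apply: SpN; apply: SpMM.
move=> g /key [gSp _]; move: (gSp 1 Sp1); rewrite (mulr1 (rho g)).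
move=> [x [y [z [w [Tx Ty Tz Tw ->]]]]].
(* The trace of x + y N + z M + w N M is 2 x + w u. *)
rewrite !raddfD /= !mxtraceZ trN trM mxtrace_scalar !mulr0 !addr0.
by apply: polyvalD; [rewrite mulr2n; apply: polyvalD | apply: polyvalM => //; apply: polyvalX].
Qed.

End Traces.

(** * Rational functions and their places at zero and infinity *)

Lemma fraction_numden (R : idomainType) (x : {fraction R}) :
  exists a b, b != 0 /\ x * tofrac b = tofrac a.
Proof.
elim/quotW: x => x; exists (frac x).1, (frac x).2; split; first exact: denom_ratioP.
rewrite -[LHS]/(FracField.mul _ _) !piE; apply/eqmodP.
rewrite /= /FracField.mulf FracField.equivfE.
rewrite !numden_Ratio ?mulf_neq0 ?oner_eq0 ?denom_ratioP //.
by rewrite !mulr1 mulrC.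
Qed.

Definition const_frac (F : fieldType) : {rmorphism F -> {fraction {poly F}}} :=
  (@FracField.tofrac {poly F}) \o polyC.

Section RationalFunctions.

Context {F : fieldType}.
Local Notation K := {fraction {poly F}}.
Local Notation iota := (const_frac F).
Implicit Types (x y u : K) (a b f g : {poly F}) (c : F).

(** This is the n-th power of the maximal ideal in the local ring of [F[X]] at the origin. *)
Definition vanishes n x :=
  exists f g, g.[0] != 0 /\ x * tofrac g = tofrac ('X^n * f).

Lemma vanishes_poly n f : vanishes n (tofrac ('X^n * f)).
Proof. by exists f, 1; rewrite hornerC oner_eq0 rmorph1 mulr1. Qed.

Lemma vanishes0 n : vanishes n 0.
Proof. by exists 0, 1; rewrite hornerC oner_eq0 mulr0 mul0r rmorph0. Qed.

Lemma vanishesD n x y : vanishes n x -> vanishes n y -> vanishes n (x + y).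
Proof.
move=> [f [g [g0 xg]]] [f' [g' [g0' yg]]]; exists (f * g' + f' * g), (g * g').
rewrite hornerM mulf_neq0 //; split=> //.
have -> : (x + y) * tofrac (g * g') =
    (x * tofrac g) * tofrac g' + (y * tofrac g') * tofrac g by rewrite rmorphM; ring.
by rewrite xg yg -!rmorphM -rmorphD; congr tofrac; ring.
Qed.

Lemma vanishesN n x : vanishes n x -> vanishes n (- x).
Proof.
move=> [f [g [g0 xg]]]; exists (- f), g; split=> //.
by rewrite mulNr xg -rmorphN mulrN.
Qed.

Lemma vanishesM m n x y : vanishes m x -> vanishes n y -> vanishes (m + n) (x * y).
Proof.
move=> [f [g [g0 xg]]] [f' [g' [g0' yg]]]; exists (f * f'), (g * g').
rewrite hornerM mulf_neq0 //; split=> //.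
by rewrite rmorphM mulrACA xg yg -rmorphM exprD; congr tofrac; ring.
Qed.

Lemma vanishesS n x : vanishes n.+1 x -> vanishes n x.
Proof.
move=> [f [g [g0 xg]]]; exists ('X * f), g; split=> //.
by rewrite xg exprSr mulrA.
Qed.

(** Denominators [g] are coprime to X, so X^(size a) divides the numerator [a] of [x], and a nonzero
    [a] has too small a degree. *)
Lemma vanishes_sep x : (forall n, vanishes n x) -> x = 0.
Proof.
move=> vx; have [a [b [b0 xb]]] := fraction_numden _ x.
have [f [g [g0 xg]]] := vx (size a).
have ag : a * g = 'X^(size a) * (f * b).
  apply/eqP; rewrite -tofrac_eq !rmorphM /= -xb.
  by rewrite mulrAC xg rmorphM mulrA.
have cop : coprimep 'X^(size a) g.
  apply: coprimep_expl; rewrite coprimep_sym -['X]subr0 -polyC0 coprimep_XsubC.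
  exact: g0.
have: 'X^(size a) %| a by rewrite -(Gauss_dvdpl _ cop) ag dvdp_mulIl.
have [a0 _|a0 /(dvdp_leq a0)] := eqVneq a 0; last by rewrite size_polyXn ltnn.
by move/eqP: xb; rewrite a0 rmorph0 mulf_eq0 tofrac_eq0 (negPf b0) orbF => /eqP.
Qed.

(* [bounded] and [pole] refer to the place at infinity. *)
Definition bounded x :=
  exists a b, [/\ b != 0, x * tofrac b = tofrac a & (size a <= size b)%N].

Definition pole x :=
  exists a b, [/\ b != 0, x * tofrac b = tofrac a & (size b < size a)%N].

Lemma bounded_or_pole x : bounded x \/ pole x.
Proof.
have [a [b [b0 xb]]] := fraction_numden _ x.
by case: (leqP (size a) (size b)) => ab; [left | right]; exists a, b.
Qed.

Lemma bounded_not_pole x : bounded x -> ~ pole x.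
Proof.
move=> [a [b [b0 xb ab]]] [a' [b' [b0' xb' ab']]].
have e : a * b' = a' * b.
  by apply/eqP; rewrite -tofrac_eq !rmorphM /= -xb -xb' mulrAC.
have a0' : a' != 0 by rewrite -size_poly_gt0 (leq_ltn_trans _ ab').
have a0 : a != 0.
  by apply: contraNneq (mulf_neq0 a0' b0) => a0; rewrite -e a0 mul0r.
have := congr1 (fun f : {poly F} => size f) e; rewrite !size_mul //.
have : (0 < size a)%N by rewrite size_poly_gt0.
by move: ab ab'; move: (size a) (size b) (size a') (size b') => m n m' n'; lia.
Qed.

Lemma bounded_affine x y c : bounded x -> bounded y -> bounded (x * y + iota c).
Proof.
move=> [a [b [b0 xb ab]]] [a' [b' [b0' yb ab']]].
exists (a * a' + c%:P * (b * b')), (b * b'); split; first exact: mulf_neq0.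
  by rewrite mulrDl rmorphD !rmorphM /= mulrACA xb yb.
apply: leq_trans (size_polyD _ _) _; rewrite geq_max; apply/andP; split.
  have [->|a0] := eqVneq a 0; first by rewrite mul0r size_poly0.
  have [->|a0'] := eqVneq a' 0; first by rewrite mulr0 size_poly0.
  rewrite !size_mul //.
  by move: ab ab'; move: (size a) (size b) (size a') (size b') => m n m' n'; lia.
have [->|c0] := eqVneq c 0; first by rewrite polyC0 mul0r size_poly0.
by rewrite size_Cmul.
Qed.

Lemma pole_addC x c : pole x -> pole (x + iota c).
Proof.
move=> [a [b [b0 xb ab]]]; exists (a + c%:P * b), b; split=> //.
  by rewrite mulrDl xb rmorphD rmorphM.
rewrite size_polyDl //; apply: leq_ltn_trans ab.
have [->|c0] := eqVneq c 0; first by rewrite polyC0 mul0r size_poly0.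
by rewrite size_Cmul.
Qed.

Lemma poleM x y : pole x -> pole y -> pole (x * y).
Proof.
move=> [a [b [b0 xb ab]]] [a' [b' [b0' yb ab']]].
have a0 : a != 0 by rewrite -size_poly_gt0 (leq_ltn_trans _ ab).
have a0' : a' != 0 by rewrite -size_poly_gt0 (leq_ltn_trans _ ab').
exists (a * a'), (b * b'); split; first exact: mulf_neq0.
  by rewrite rmorphM mulrACA xb yb -rmorphM.
rewrite !size_mul //.
by move: ab ab'; move: (size a) (size b) (size a') (size b') => m n m' n'; lia.
Qed.

Lemma pole_scale x c : c != 0 -> pole x -> pole (iota c * x).
Proof.
move=> c0 [a [b [b0 xb ab]]]; exists (c%:P * a), b; split=> //.
  by rewrite -mulrA xb rmorphM.
by rewrite size_Cmul.
Qed.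

Lemma polyval_bounded u x : bounded u -> polyval iota u x -> bounded x.
Proof.
move=> bu [f ->]; elim/poly_ind: f => [|f c IH].
  by exists 0, 1; rewrite oner_eq0 rmorph0 horner0 mul0r size_poly0 rmorph0.
rewrite rmorphD rmorphM /= map_polyX map_polyC !hornerE.
exact: bounded_affine.
Qed.

(** Induction along Horner's scheme: in f(u) u + c, the factor f(u) is zero, a nonzero constant or
    has a pole, and in the last two cases the pole of [u] survives. *)
Lemma polyval_pole u x : pole u -> polyval iota u x ->
  (exists c, x = iota c) \/ pole x.
Proof.
move=> pu [f ->]; elim/poly_ind: f => [|f c IH].
  by left; exists 0; rewrite rmorph0 horner0 rmorph0.
rewrite rmorphD rmorphM /= map_polyX map_polyC !hornerE.
case: IH => [[d ->]|pf]; last by right; apply/pole_addC/poleM.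
have [->|d0] := eqVneq d 0; first by left; exists c; rewrite rmorph0 mul0r add0r.
by right; apply/pole_addC/pole_scale.
Qed.

(* A polynomial in [u] that has no pole at infinity is constant, unless [u] has no pole
   there either. *)
Lemma no_common_polyval u : (2 : F) != 0 ->
  polyval iota u (tofrac ('X ^+ 2)) ->
  ~ polyval iota u (2 / (1 + tofrac 'X ^+ 4)).
Proof.
move=> two0 ux ue; pose d : {poly F} := 1 + 'X^4.
have dE : 1 + tofrac 'X ^+ 4 = tofrac d by rewrite rmorphD rmorphXn rmorph1.
have sd : size d = 5 by rewrite /d addrC size_polyDl size_polyXn ?size_poly1.
have d0 : d != 0 by rewrite -size_poly_gt0 sd.
have dK : tofrac d != 0 by rewrite tofrac_eq0.
have pX : pole (tofrac 'X^2).
  by exists 'X^2, 1; rewrite oner_eq0 rmorph1 mulr1 size_polyXn size_poly1.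
have [bu|pu] := bounded_or_pole u.
  exact: (bounded_not_pole _ (polyval_bounded _ _ bu ux) pX).
have two : (2 : K) = tofrac 2%:P by rewrite polyC_natr rmorph_nat.
have be : bounded (2 / tofrac d).
  exists 2%:P, d; rewrite d0 divfK // two sd.
  by rewrite size_polyC two0.
rewrite dE in ue; case: (polyval_pole _ _ pu ue) => [[c e]|]; last exact: bounded_not_pole.
(* A constant value [c] would give 2 = c d, impossible since d has degree 4 and 2 is nonzero. *)
have : 2%:P = c%:P * d.
  have ec : tofrac c%:P = 2 / tofrac d by rewrite e.
  by apply/eqP; rewrite -tofrac_eq rmorphM /= ec -two divfK.
move/(congr1 (fun f : {poly F} => size f)); rewrite size_polyC two0.
have [->|c0] := eqVneq c 0; first by rewrite polyC0 mul0r size_poly0.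
by rewrite size_Cmul // sd.
Qed.

End RationalFunctions.

(** The characteristic polynomial is (X - 1)^2, so A - 1 squares to zero, and Frobenius gives A^p -
    1 = (A - 1)^p = 0. *)
Lemma unipotent_torsion (K : fieldType) p (A : 'M[K]_2) : p \in [pchar K] ->
  \det A = 1 -> \tr A = 2 -> A ^+ p = 1.
Proof.
move=> pK dA tA.
have pM : p \in [pchar 'M[K]_2] by rewrite pchar_lalg.
have NN : (A - 1) * (A - 1) = 0.
  rewrite cayley_hamilton2.
  have -> : \tr (A - 1) = \tr A - 2 by rewrite !trace2 !mxE /=; ring.
  have -> : \det (A - 1) = \det A - \tr A + 1 by rewrite !det2 trace2 !mxE /=; ring.
  by rewrite dA tA subrr scale0r -[1 - 2]opprB addrK addNr raddf0 subr0.
have: (A - 1) ^+ p = 0.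
  by have := prime_gt1 (pcharf_prime pK); case: (p) => [|[|n]] // _; rewrite !exprS mulrA NN mul0r.
rewrite -(pFrobenius_autE pM) pFrobenius_autB_comm; last exact: commr1.
by rewrite !pFrobenius_autE expr1n => /eqP; rewrite subr_eq0 => /eqP.
Qed.

(** * The explicit matrices *)

Section ExampleMatrices.

Context {K : fieldType} (s : K).
Let e := (1 + s ^+ 4)^-1.

Definition exA : 'M[K]_2 := mx2 K 1 s 0 1.
(** Each entry is displayed as 0 or 1 plus a multiple of [s], which shows the congruence to 1 modulo
    [s]. The lower right entry equals (1 - s^4) e. *)
Definition exY : 'M[K]_2 := mx2 K 1 (s * - (2 * s ^+ 2 * e)) s (1 + s * - (2 * s ^+ 3 * e)).
Definition exA' : 'M[K]_2 := mx2 K 1 (- s) 0 1.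
Definition exY' : 'M[K]_2 := mx2 K (1 + s * - (2 * s ^+ 3 * e)) (s * (2 * s ^+ 2 * e)) (- s) 1.

Lemma det_exA : \det exA = 1.
Proof. by rewrite det2 !mx2E; ring. Qed.

Lemma mul_exA : exA * exA' = 1.
Proof. by apply: mx2P; rewrite !mul2 !mx2E !mxE /=; ring. Qed.

Lemma trace_exA : \tr exA = 2.
Proof. by rewrite trace2 !mx2E; ring. Qed.

Lemma trace_exAY : \tr (exA * exY) - \tr exY = s ^+ 2.
Proof. by rewrite !trace2 !mul2 !mx2E; ring. Qed.

Hypothesis s0 : 1 + s ^+ 4 != 0.

Lemma det_exY : \det exY = 1.
Proof. by rewrite det2 !mx2E /e; field. Qed.

Lemma mul_exY : exY * exY' = 1.
Proof. by apply: mx2P; rewrite !mul2 !mx2E !mxE /= /e; field. Qed.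

Lemma trace_exY : \tr exY = 2 / (1 + s ^+ 4).
Proof. by rewrite trace2 !mx2E /e; field. Qed.

Lemma det_exC : \det (exY * (exY * (exA * (exY' * exA')))) = 1.
Proof. by rewrite !detM det_exY det_exA !det2 !mx2E /e; field. Qed.

(** From tr(y g) = tr(y) tr(g) - tr(y^-1 g) with g = y a y^-1 a^-1, this trace is tr(y) (tr(g) - 1).
    As [a] is unipotent with upper entry s and y has lower left entry s, tr(g) = 2 + s^4. So the
    trace is 2 exactly when tr(y) = 2 / (1 + s^4); with first column (1, s) and determinant 1, this
    determines [exY]. *)
Lemma trace_exC : \tr (exY * (exY * (exA * (exY' * exA')))) = 2.
Proof. by rewrite trace2 !mul2 !mx2E /e; field. Qed.

End ExampleMatrices.

Lemma linear_example p : prime p -> odd p ->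
  exists (H : AbsGroup) (a y : H), [/\ residually_nilpotent H, rels p H a y
    & forall c d : H, gpow H c p = gone -> gpow H d p = gone ->
      gen H (pair_set H c d) a -> ~ gen H (pair_set H c d) y].
Proof.
move=> pp podd; pose F : fieldType := 'F_p; pose K := {fraction {poly F}}.
have pF : p \in [pchar F] := pchar_Fp pp.
have pK : p \in [pchar K] := rmorph_pchar (const_frac F) pF.
have two0 : (2 : F) != 0.
  rewrite -(dvdn_pcharf pF); apply: contraL podd => p2.
  have := prime_gt1 pp; have := dvdn_leq (isT : (0 < 2)%N) p2 => ? ?.
  by have -> : p = 2%N by lia.
pose s : K := tofrac 'X; pose e : K := (1 + s ^+ 4)^-1.
have s0 : 1 + s ^+ 4 != 0.
  rewrite /s -rmorphXn -(rmorph1 (@FracField.tofrac {poly F})) -rmorphD tofrac_eq0.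
  by rewrite -size_poly_gt0 addrC size_polyDl size_polyXn ?size_poly1.
have [H [rho [rn rho1 rhoM rho_inj rho_im]]] :=
  @congruence_group K vanishes vanishes0 vanishesD vanishesN vanishesM vanishesS vanishes_sep.
(* The denominator 1 + X^4 takes the value 1 at the origin, so [e] lies in the local ring. *)
have ve : vanishes 0 e.
  exists 1, (1 + 'X^4); split; first by rewrite hornerD hornerXn expr0n addr0 (hornerC 1) oner_eq0.
  by rewrite rmorphD rmorphXn rmorph1 mulVf // mulr1 rmorph1.
have vs : vanishes 1 s by have := @vanishes_poly F 1 1; rewrite mulr1.
have vM (x : K) : vanishes 0 x -> vanishes 1 (s * x).
  by move=> vx; exact: vanishesM vs vx.
have vX n : vanishes 0 (s ^+ n).
  by have := @vanishes_poly F 0 'X^n; rewrite expr0 mul1r rmorphXn.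
have v2 : vanishes 0 (2 : K).
  have := @vanishes_poly F 0 2; rewrite expr0 mul1r.
  by rewrite rmorph_nat.
have vM0 (x y : K) : vanishes 0 x -> vanishes 0 y -> vanishes 0 (x * y).
  by move=> vx vy; exact: vanishesM vx vy.
have J4 (M : 'M[K]_2) : vanishes 1 (M 0 0) -> vanishes 1 (M 0 1) ->
    vanishes 1 (M 1 0) -> vanishes 1 (M 1 1) -> forall i j, vanishes 1 (M i j).
  by move=> ? ? ? ? i j; case: (ord2P i) => ->; case: (ord2P j) => ->.
have [a ra] : exists a, rho a = exA s.
  apply: rho_im (det_exA _) _.
  by apply: J4; rewrite !mxE /= ?subrr ?subr0 //; exact: vanishes0.
have [y ry] : exists y, rho y = exY s.
  apply: rho_im (det_exY _ s0) _.
  have v3 n : vanishes 1 (s * - (2 * s ^+ n * e)).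
    exact (vM _ (vanishesN _ _ (vM0 _ _ (vM0 _ _ v2 (vX n)) ve))).
  apply: J4; rewrite !mxE /= ?subrr ?subr0 //; first exact: vanishes0.
  by rewrite addrC addKr.
have rhoV g M : rho g * M = 1 -> rho (ginv g) = M.
  by move=> gM; rewrite -[LHS]mulr1 -[X in _ * X = _]gM mulrA -rhoM gmulV rho1 mul1r.
have rhoX g n : rho (gpow H g n) = rho g ^+ n.
  by elim: n => [|n IH] //=; rewrite rhoM IH exprS.
have ra' : rho (ginv a) = exA' s by apply: rhoV; rewrite ra mul_exA.
have ry' : rho (ginv y) = exY' s by apply: rhoV; rewrite ry mul_exY.
exists H, a, y; split=> //.
- split; apply: rho_inj; rewrite rhoX rho1; apply: unipotent_torsion => //.
  + by rewrite ra det_exA.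
  + by rewrite ra trace_exA.
  + by rewrite /ctwist !rhoM ra ra' ry ry' det_exC.
  + by rewrite /ctwist !rhoM ra ra' ry ry' trace_exC.
- move=> c d cp dp ga gy.
  have [u pu] := two_torsion_traces (const_frac F) p H rho c d pK rho1 rhoM cp dp.
  have py := pu y gy; rewrite ry (trace_exY _ s0) in py.
  apply: (no_common_polyval u two0 _ py).
  have -> : tofrac ('X ^+ 2) = \tr (rho (gmul a y)) - \tr (rho y).
    by rewrite rhoM ra ry trace_exAY rmorphXn.
  by apply: polyvalD; [apply: pu; apply: gen_mul | apply: polyvalN; apply: pu].
Qed.

End LinearGroups.

(** * The two groups *)

Definition fin_group (gT : finGroupType) : AbsGroup :=
  Build_AbsGroup gT (fun x y => (x * y)%g) 1%g (fun x => (x^-1)%g)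
    (@mulgA gT) (@mul1g gT) (@mulVg gT).

(* The alternating group on five points, with [x] a double transposition and [y] a 5-cycle. *)
Lemma perfect_example : exists (P : AbsGroup) (x y : P),
  [/\ x <> gone, gmul x x = gone & forall z, gen P (pair_set P x y) z] /\
  [/\ exists u v, x = comm P u v, exists u v, y = comm P u v
    & exists g h, y = gmul (gconj P g x) (gconj P h x)].
Proof.
(* The five points are [None] and four pairs: [f] swaps the pairs with equal first coordinate and
   fixes [None], [g] is a 5-cycle and [g'] its inverse. *)
pose T := option (bool * bool).
pose f (i : T) : T := if i is Some (a, b) then Some (a, ~~ b) else None.
pose g (i : T) : T := match i with
  | None => Some (false, false) | Some (false, false) => Some (true, false)
  | Some (true, false) => Some (false, true) | Some (false, true) => Some (true, true)
  | Some (true, true) => None end.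
pose g' (i : T) : T := match i with
  | Some (false, false) => None | Some (true, false) => Some (false, false)
  | Some (false, true) => Some (true, false) | Some (true, true) => Some (false, true)
  | None => Some (true, true) end.
have fK : cancel f f by do !case.
have gK : cancel g g' by do !case.
have g'K : cancel g' g by do !case.
pose S := fin_group {perm T}.
pose x : S := perm (can_inj fK); pose y : S := perm (can_inj gK).
pose z : S := perm (can_inj g'K).
have xx : gmul x x = gone :> S.
  by apply/permP => i; rewrite permM perm1 !permE.
have yz : gmul y z = gone :> S.
  by apply/permP => i; rewrite permM perm1 !permE.
have xV : ginv x = x by apply: ginv_unique.
have yV : ginv y = z by apply: ginv_unique.
have zV : ginv z = y by rewrite -yV ginv_inv.
have [P [i [iM i_inj imP]]] := subgroup_group _ _ (gen_subgroup S (pair_set S x y)).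
have [x1 xE] : exists x1, i x1 = x by apply/imP/gen_in; left.
have [y1 yE] : exists y1, i y1 = y by apply/imP/gen_in; right.
exists P, x1, y1; split; split.
- move/(congr1 i); rewrite xE (hom_one iM).
  by move/permP/(_ (Some (true, true))); rewrite perm1 permE.
- by apply: i_inj; rewrite iM xE (hom_one iM).
- move=> w; have : gen S (pair_set S x y) (i w) by apply/imP; exists w.
  have key v : gen S (pair_set S x y) v -> forall w, i w = v -> gen P (pair_set P x1 y1) w.
    elim=> [u [] -> {}w|{}w|u u' gu IHu gu' IHu' {}w|u gu IHu {}w].
    + by rewrite -xE => /i_inj ->; apply: gen_in; left.
    + by rewrite -yE => /i_inj ->; apply: gen_in; right.
    + by rewrite -(hom_one iM) => /i_inj ->; apply: gen_one.
    + have /imP [v1 e1] := gu; have /imP [v2 e2] := gu'.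
      by rewrite -e1 -e2 -iM => /i_inj ->; apply: gen_mul; [exact: IHu | exact: IHu'].
    + have /imP [v1 e1] := gu.
      by rewrite -e1 -(hom_inv iM) => /i_inj ->; apply: gen_inv; exact: IHu.
  by move=> gw; apply: key gw w erefl.
(* The witnesses here and below are explicit words, checked by evaluating both sides at the five
   points. *)
- pose u := gmul (gmul (ginv y1) (ginv y1)) (gmul x1 (ginv y1)).
  pose v := gmul (gmul y1 y1) (gmul x1 y1).
  exists u, v; apply: i_inj.
  rewrite /comm !(iM, hom_inv iM) xE yE !ginv_mul !ginv_inv xV yV.
  by apply/permP => t; rewrite !permM !permE; case: t => [[[] []]|].
- pose u := gmul x1 (gmul y1 x1).
  pose v := gmul (ginv y1) (gmul x1 (ginv y1)).
  exists u, v; apply: i_inj.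
  rewrite /comm !(iM, hom_inv iM) xE yE !ginv_mul !ginv_inv xV yV.
  by apply/permP => t; rewrite !permM !permE; case: t => [[[] []]|].
(* A 5-cycle is a rotation of a pentagon, hence a product of two reflections, which are double
   transpositions. *)
- pose u := gmul y1 x1; pose v := gmul (ginv y1) (gmul x1 (ginv y1)).
  exists u, v; apply: i_inj.
  rewrite /gconj !(iM, hom_inv iM) xE yE !ginv_mul !ginv_inv xV yV.
  by apply/permP => t; rewrite !permM !permE; case: t => [[[] []]|].
Qed.

(** * Direct products with a perfect group *)

Lemma fst_hom (G P : AbsGroup) : is_hom (prod_group G P) G (fun z => z.1).
Proof. by []. Qed.

Lemma snd_hom (G P : AbsGroup) : is_hom (prod_group G P) P (fun z => z.2).
Proof. by []. Qed.

Lemma inl_hom (G P : AbsGroup) : is_hom G (prod_group G P) (fun x => (x, gone)).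
Proof. by move=> x y; rewrite /= gmul1. Qed.

Lemma inr_hom (G P : AbsGroup) : is_hom P (prod_group G P) (fun z => (gone, z)).
Proof. by move=> x y; rewrite /= gmul1. Qed.

Lemma sub_pow (G : AbsGroup) (S : G -> Prop) x n : is_subgroup G S -> S x -> S (gpow G x n).
Proof.
move=> sS Sx; elim: n => [|n IH] /=; first exact: sub_one sS.
exact: (sub_mul sS Sx IH).
Qed.

Lemma sub_conj (G : AbsGroup) (S : G -> Prop) g x :
  is_subgroup G S -> S g -> S x -> S (gconj G g x).
Proof.
move=> sS Sg Sx; apply: (sub_mul sS); first exact: (sub_inv sS).
exact: (sub_mul sS).
Qed.

Lemma gpow_involution (G : AbsGroup) (x : G) n :
  gmul x x = gone -> gpow G x n = if odd n then x else gone.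
Proof.
move=> xx; elim: n => //= n ->.
by case: (odd n) => /=; rewrite ?xx ?gmul_oner.
Qed.

(* Raising [(a, x)] to the power [p] isolates the involution [x], whose conjugates
   generate [P]. *)
Lemma gen_prod_group p (G P : AbsGroup) (a y : G) (x z g h : P) : odd p ->
  gpow G a p = gone -> (forall w, gen G (pair_set G a y) w) ->
  gmul x x = gone -> (forall w, gen P (pair_set P x z) w) ->
  z = gmul (gconj P g x) (gconj P h x) ->
  forall w, gen (prod_group G P) (pair_set (prod_group G P) (a, x) (y, z)) w.
Proof.
move=> podd ap Gay xx Pxz zE.
set GP := prod_group G P; set S := gen GP _; have sS : is_subgroup GP S := gen_subgroup _ _.
have lift v : exists w, S (w, v).
  have [|[w v'] [Sw /= <-]] := gen_min _ _ _ (hom_im (snd_hom G P) _ sS) _ v (Pxz v).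
    by move=> _ [] ->; [exists (a, x) | exists (y, z)]; split=> //; apply: gen_in; [left | right].
  by exists w.
have Sx : S (gone, x).
  have -> : (gone, x) = gpow GP (a, x) p.
    rewrite [RHS]surjective_pairing (hom_pow (fst_hom G P)) (hom_pow (snd_hom G P)) /=.
    by rewrite ap gpow_involution ?podd.
  by apply: sub_pow => //; apply: gen_in; left.
(* Conjugating [(gone, x)] by any element of [S] above [v] leaves the first coordinate trivial. *)
have Sxc v : S (gone, gconj P v x).
  have [w Sw] := lift v; have := sub_conj _ _ _ _ sS Sw Sx.
  by rewrite /gconj /= gmul1 gmulV.
have SP v : S (gone, v).
  move: (Pxz v); apply: (gen_min _ _ _ (hom_preim (inr_hom G P) _ sS)).
  by move=> _ [] -> //; rewrite zE inr_hom; apply: (sub_mul sS).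
move=> [w v].
have [|[w' v'] [Sw /= <-]] := gen_min _ _ _ (hom_im (fst_hom G P) _ sS) _ w (Gay w).
  by move=> _ [] ->; [exists (a, x) | exists (y, z)]; split=> //; apply: gen_in; [left | right].
have := sub_mul sS Sw (SP (gmul (ginv v') v)).
by rewrite /= gmul_oner gmul_Kinv.
Qed.

(** An inverse on representatives is chosen using surjectivity modulo [gamma H i], and both
    congruences become equalities in the quotient of [H]. Both directions are given because
    [quot_iso] asks only its first map to be multiplicative. *)
Lemma quot_iso_of_hom (G H : AbsGroup) (f : G -> H) i : is_hom G H f ->
  (forall x, gamma H i (f x) -> gamma G i x) ->
  (forall z, exists x, gamma H i (gmul (ginv (f x)) z)) ->
  quot_iso G (gamma G i) H (gamma H i) /\ quot_iso H (gamma H i) G (gamma G i).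
Proof.
move=> fM finj fsur.
have [Q [pi [piM piS piE _]]] := gamma_quotient H i.
have congrH z w : congr_mod H (gamma H i) z w <-> pi z = pi w.
  rewrite /congr_mod -piE piM (hom_inv piM); split=> [/gmul_inv_eq //|->]; exact: gmulV.
have congrG x y : congr_mod G (gamma G i) x y <-> pi (f x) = pi (f y).
  rewrite -congrH /congr_mod -(hom_inv fM) -fM; split; [exact: hom_gamma | exact: finj].
pose g z := proj1_sig (constructive_indefinite_description _ (fsur z)).
have gK z : pi (f (g z)) = pi z.
  by rewrite /g; case: constructive_indefinite_description => x /= /congrH.
have f_congr x y : congr_mod G (gamma G i) x y -> congr_mod H (gamma H i) (f x) (f y).
  by move/congrG/congrH.
have g_congr z w : congr_mod H (gamma H i) z w -> congr_mod G (gamma G i) (g z) (g w).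
  by move/congrH => zw; apply/congrG; rewrite !gK.
have fg z : congr_mod H (gamma H i) (f (g z)) z by apply/congrH.
have gf x : congr_mod G (gamma G i) (g (f x)) x by apply/congrG.
split; [exists f, g | exists g, f]; do !split=> //.
- by move=> x y; apply/congrH; rewrite fM.
- by move=> z w; apply/congrG; rewrite gK fM !piM !gK.
Qed.

(** This is the invariant that separates both groups from [C_p * C_p]. *)
Lemma free_prod_iso_gen p (G F : AbsGroup) : is_free_prod_CpCp p F -> isomorphic G F ->
  exists c d : G, [/\ gpow G c p = gone, gpow G d p = gone
    & forall w, gen G (pair_set G c d) w].
Proof.
move=> [a [b [ap [_ [bp [_ [Fab _]]]]]]] [f [g [fM [gf fg]]]].
have gM : is_hom F G g by move=> x y; rewrite -{1}(fg x) -{1}(fg y) -fM gf.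
exists (g a), (g b); split; rewrite -?(hom_pow gM) ?ap ?bp ?(hom_one gM) // => w.
rewrite -(gf w); apply: (hom_gen gM) (Fab (f w)).
by move=> _ [] ->; [left | right].
Qed.

Lemma cyclic_comm (G : AbsGroup) (c : G) : (forall z, gen G (fun w => w = c) z) ->
  forall x y : G, gmul x y = gmul y x.
Proof.
move=> Gc.
have centralizer z : is_subgroup G (fun x => gmul x z = gmul z x).
  split=> [|x y xz yz|x xz]; first by rewrite gmul1 gmul_oner.
    by rewrite -gmulA yz gmulA xz gmulA.
  by apply: (gmul_cancel x); rewrite gmul_Kinv gmulA xz -gmulA gmul_invr gmul_oner.
have cz z : gmul c z = gmul z c.
  by apply/esym/(gen_min _ _ _ (centralizer c) _ z (Gc z)) => _ ->.
by move=> x y; apply: (gen_min _ _ _ (centralizer y) _ x (Gc x)) => _ ->.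
Qed.

(** This reduces noncyclicity to the same invariant: in a cyclic group the relations make [y] itself
    p-torsion, so [a] and [y] would be two p-torsion generators. *)
Lemma cyclic_ctwist (G : AbsGroup) (c a y : G) : (forall z, gen G (fun w => w = c) z) ->
  ctwist G a y = y.
Proof.
move=> /cyclic_comm comm; rewrite /ctwist (comm (ginv y)) (gmulA _ a) gmul_invr gmul1.
by rewrite gmul_invr gmul_oner.
Qed.

(** The map [f] sends the two free factors to [a] and [ctwist G a y]; its image is everything modulo
    each term by [subgroup_mod_gamma]. For injectivity, a solution of c(b,v) = c modulo [gamma F i]
    yields a map from [G] to the quotient of [F] whose composite with [f] is the projection. *)
Lemma free_prod_nilpotent_quotients p (G F : AbsGroup) (a y : G) :
  is_free_prod_CpCp p F -> rels p G a y -> (forall z, gen G (pair_set G a y) z) ->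
  (forall (H : AbsGroup) (b x : H), residually_nilpotent H -> rels p H b x ->
     exists f : G -> H, [/\ is_hom G H f, f a = b & f y = x]) ->
  exists f : F -> G, is_hom F G f /\ forall i, 0 < i ->
    (forall x, gamma G i (f x) -> gamma F i x) /\
    (forall z, exists x, gamma G i (gmul (ginv (f x)) z)).
Proof.
move=> [b [c [bp [_ [cp [_ [Fbc Funiv]]]]]]] [ap yp] Gay Guniv.
have [f [fM [fb fc]]] := Funiv G a (ctwist G a y) ap yp.
exists f; split=> // i i0; split=> [x gfx|z]; last first.
  have [|||_ [[w [_ <-]] gs]] := subgroup_mod_gamma _ a y _ Gay
      (hom_im fM (fun _ => True) _) _ _ i z.
  - by [].
  - by exists b.
  - by exists c.
  - by exists w.
have [v gv] := ctwist_solve F b c i.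
have [Q [pi [piM piS piE Qi]]] := gamma_quotient F i.
have vc : ctwist Q (pi b) (pi v) = pi c.
  move/piE: gv; rewrite piM (hom_inv piM) (hom_ctwist _ _ _ piM).
  by move/gmul_inv_eq.
(* The quotient is nilpotent, so the universal property of [G] applies to it. *)
have Qrn : residually_nilpotent Q by move=> z gz; apply: Qi; apply: gz.
have Qrel : rels p Q (pi b) (pi v).
  by split; rewrite ?vc -(hom_pow piM) ?bp ?cp (hom_one piM).
have [h [hM ha hy]] := Guniv Q _ _ Qrn Qrel.
have hf w : h (f w) = pi w.
  apply: (hom_eq_gen F Q _ _ _ (hom_comp _ _ _ _ _ fM hM) piM _ w (Fbc w)).
  move=> _ [] ->; first by rewrite fb.
  by rewrite fc (hom_ctwist _ _ _ hM) ha hy.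
by apply/piE; rewrite -hf; apply: Qi; apply: (hom_gamma hM).
Qed.

Theorem theorem2 (p : nat) (hp : prime p) (hodd : odd p) :
  exists G1 G2 : AbsGroup,
    rank_two G1 /\ rank_two G2 /\
    (forall F : AbsGroup, is_free_prod_CpCp p F ->
       ~ isomorphic G1 F /\ ~ isomorphic G2 F /\
       (forall i, 1 <= i ->
          quot_iso G1 (gamma G1 i) G2 (gamma G2 i) /\
          quot_iso G1 (gamma G1 i) F (gamma F i) /\
          quot_iso G2 (gamma G2 i) F (gamma F i))) /\
    residually_nilpotent G1 /\ ~ residually_nilpotent G2.
Proof.
have [G [a [y [Grn [ap yp] Gay Guniv]]]] := universal_group p.
have [P [x [z [[x1 xx Pxz] [xcomm zcomm [g [h zE]]]]]]] := perfect_example.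
have [H [aH [yH [Hrn Hrel Hgen]]]] := linear_example p hp hodd.
have [f [fM fa fy]] := Guniv H aH yH Hrn Hrel.
pose G2 := prod_group G P.
have Pgamma i w : gamma P i w.
  by apply: gamma_perfect Pxz _ i w => _ [] ->.
(* Two such generators would map to p-torsion elements of the linear group [H] generating a subgroup
   that contains [aH] and [yH]. *)
have notorsion : ~ exists c d : G, [/\ gpow G c p = gone, gpow G d p = gone
    & forall w, gen G (pair_set G c d) w].
  move=> [c [d [cp dp Gcd]]].
  have Hcd w : gen H (pair_set H (f c) (f d)) (f w).
    by apply: (hom_gen fM) (Gcd w) => _ [] ->; [left | right].
  apply: (Hgen (f c) (f d)); rewrite -?(hom_pow fM) ?cp ?dp ?(hom_one fM) //.
    by rewrite -fa.
  by rewrite -fy.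
have Gnotcyclic : ~ exists c : G, forall w, gen G (fun v => v = c) w.
  move=> [c Gc]; apply: notorsion; exists a, y; split=> //.
  by rewrite -{1}(cyclic_ctwist _ _ a y Gc).
have G2gen := gen_prod_group p G P a y x z g h hodd ap Gay xx Pxz zE.
have G2rank : rank_two G2.
  split; first by exists (a, x), (y, z).
  move=> [c Gc]; apply: Gnotcyclic; exists c.1 => w.
  by apply: (hom_gen (fst_hom G P)) (Gc (w, gone)) => _ ->.
(* As [P] is perfect, each term of the series of [G2] contains the full factor [P]. *)
have G2gamma i w v : gamma G i w -> gamma G2 i (w, v).
  move=> gw; have := sub_mul (gamma_subgroup G2 i) (hom_gamma (inl_hom G P) _ _ gw)
    (hom_gamma (inr_hom G P) _ _ (Pgamma i v)).
  by rewrite /= gmul_oner gmul1.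
exists G, G2; split; first by split=> //; exists a, y.
split=> //; split; last first.
  (* The nontrivial element [(gone, x)] lies in every term of the series of [G2]. *)
  split=> // G2rn; apply: x1.
  by have [] := G2rn (gone, x) (fun k _ => hom_gamma (inr_hom G P) _ _ (Pgamma k x)).
move=> F Ffree; split; first by move/(free_prod_iso_gen _ _ _ Ffree).
split.
  move/(free_prod_iso_gen _ _ _ Ffree) => [c [d [cp dp G2cd]]]; apply: notorsion.
  exists c.1, d.1; split; rewrite -?(hom_pow (fst_hom G P)) ?cp ?dp // => w.
  by apply: (hom_gen (fst_hom G P)) (G2cd (w, gone)) => _ [] ->; [left | right].
move=> i i0.
have [phi [phiM /(_ i i0) [phi_inj phi_sur]]] :=
  free_prod_nilpotent_quotients p G F a y Ffree (conj ap yp) Gay Guniv.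
have [_ GF] := quot_iso_of_hom _ _ _ i phiM phi_inj phi_sur.
have inl_inj w : gamma G2 i (w, gone) -> gamma G i w.
  exact: (hom_gamma (fst_hom G P)).
have [|GG2 _] := quot_iso_of_hom _ _ _ i (inl_hom G P) inl_inj.
  move=> [w v]; exists w; apply: G2gamma; rewrite gmulV.
  exact: sub_one (gamma_subgroup G i).
have [||_ G2F] := quot_iso_of_hom _ _ _ i (hom_comp _ _ _ _ _ phiM (inl_hom G P)).
- by move=> w /inl_inj /phi_inj.
- by move=> [w v]; have [u gu] := phi_sur w; exists u; apply: G2gamma.
by [].
Qed.
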